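(* Let $p\ge 2$ be an integer, $r=p-1$, and $h=1/n$ a mesh size. Let $\mathbf F^{(L)}:[-1,0]\times[0,1]\to\mathbb R^2$ and $\mathbf F^{(R)}:[0,1]\times[0,1]\to\mathbb R^2$ have each component in $\mathcal S^p_{p-1}$ of its parameter domain, have non-vanishing Jacobian determinant on their closed parameter domains, have images $\Omega^{(L)},\Omega^{(R)}$ with disjoint interiors, and satisfy $\mathbf F^{(L)}(0,v)=\mathbf F^{(R)}(0,v)=:\mathbf F_0(v)$ for $v\in[0,1]$. Let $\Omega=\Omega^{(L)}\cup\Omega^{(R)}$, $\Gamma=\Omega^{(L)}\cap\Omega^{(R)}$, and assume $\mathbf F^{(L)},\mathbf F^{(R)}$ are analysis-suitable $G^1$-continuous at $\Gamma$ with linear coefficients $\alpha^{(L)},\alpha^{(R)},\beta^{(L)},\beta^{(R)}$. Let $\mathcal G_0,\mathcal G_1$ be linear spaces of functions on $[0,1]$ with $\mathcal G_0\times\mathcal G_1\subseteq\widehat{\mathcal V^1_\Gamma}$. Then: (i) if $\beta^{(L)}$ or $\beta^{(R)}$ is not identically zero, the dimension of $\mathcal G_0$ is bounded independently of $h$; (ii) if $\alpha^{(L)}$ and $\alpha^{(R)}$ are linearly independent, the dimension of $\mathcal G_1$ is bounded independently of $h$.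
   Context: Spline spaces: on $[0,1]$ take the uniform knots $0,h,\dots,1$; $\mathcal S^q_s([0,1])$ is the space of piecewise polynomials of degree at most $q$ on the knot intervals that are $C^s$ at interior knots (global polynomials of degree $\le q$ if $s\ge q$); analogously on $[-1,0]$, and on rectangles $[a,a+1]\times[0,1]$ $\mathcal S^q_s$ is the tensor product of the univariate spaces. $\mathcal V=\{\phi:\Omega\to\mathbb R:\ \phi\circ\mathbf F^{(S)}\in\mathcal S^p_{p-1}\text{ of the parameter domain of }\mathbf F^{(S)},\ S\in\{L,R\}\}$, $\mathcal V^1=\mathcal V\cap C^1(\Omega)$. Analysis-suitable $G^1$-continuity: there exist $\alpha^{(L)},\alpha^{(R)},\beta^{(L)},\beta^{(R)}$, polynomials of degree at most $1$ on $[0,1]$, with $\alpha^{(L)}(v)\alpha^{(R)}(v)>0$ for all $v$, such that for all $v\in[0,1]$: $\alpha^{(R)}(v)D_u\mathbf F^{(L)}(0,v)-\alpha^{(L)}(v)D_u\mathbf F^{(R)}(0,v)=(\alpha^{(R)}(v)\beta^{(L)}(v)-\alpha^{(L)}(v)\beta^{(R)}(v))D_v\mathbf F_0(v)$. Transversal vector on $\Gamma$: $\mathbf d(\mathbf F_0(v))=\frac{1}{\alpha^{(L)}(v)}(D_u\mathbf F^{(L)}(0,v)-\beta^{(L)}(v)D_v\mathbf F_0(v))$. Trace space: $\widehat{\mathcal V^1_\Gamma}=\{v\mapsto[\phi(\mathbf F_0(v)),(\nabla\phi\cdot\mathbf d)(\mathbf F_0(v))]:\phi\in\mathcal V^1\}$.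 *)

(* Defs.v *)
From HB Require Import structures.
From mathcomp Require Import all_boot all_order all_algebra.
From mathcomp Require Import all_classical all_reals all_analysis.
Set Implicit Arguments. Unset Strict Implicit. Unset Printing Implicit Defensive.
Import Order.TTheory GRing.Theory Num.Theory.
Import numFieldNormedType.Exports.
Local Open Scope classical_set_scope.
Local Open Scope ring_scope.

Section Defs.
Variable R : realType.

(* Univariate spline space S^q_s([a,a+1]) with uniform knots a + i/n, i=0..n.
   An element is represented by its canonical total extension to R: the
   polynomial pieces P 0 and P (n-1) are extended beyond the interval.
   C^s at interior knots = the derivatives of order <= s of adjacent pieces
   agree there. (If s >= q this forces a global polynomial.) *)
Definition spline (a : R) (n q s : nat) (f : R -> R) : Prop :=
  exists P : nat -> {poly R},
    (forall i, (size (P i) <= q.+1)%N) /\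
    (forall i k, (0 < i < n)%N -> (k <= s)%N ->
        (P i.-1)^`(k).[a + i%:R / n%:R] = (P i)^`(k).[a + i%:R / n%:R]) /\
    (forall i x, (i < n)%N -> a + i%:R / n%:R <= x <= a + i.+1%:R / n%:R ->
        f x = (P i).[x]) /\
    (forall x, x <= a -> f x = (P 0%N).[x]) /\
    (forall x, a + 1 <= x -> f x = (P n.-1).[x]).

Definition tspline (a : R) (n q s : nat) (F : R -> R -> R) : Prop :=
  exists (m : nat) (A B : nat -> R -> R),
    (forall k, spline a n q s (A k)) /\ (forall k, spline 0 n q s (B k)) /\
    (forall u v, F u v = \sum_(k < m) A k u * B k v).

Definition du (F : R -> R -> R) (u v : R) : R := derive1 (fun x => F x v) u.
Definition dv (F : R -> R -> R) (u v : R) : R := derive1 (fun y => F u y) v.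

Definition jac (F1 F2 : R -> R -> R) (u v : R) : R :=
  du F1 u v * dv F2 u v - dv F1 u v * du F2 u v.

Definition patch_img (F1 F2 : R -> R -> R) (a : R) : set (R * R) :=
  [set x | exists u v, a <= u <= a + 1 /\ 0 <= v <= 1 /\ x = (F1 u v, F2 u v)].

Definition dot2 (x y : R * R) : R := x.1 * y.1 + x.2 * y.2.

Definition C1_on (A : set (R * R)) (phi : R * R -> R) (Dphi : R * R -> R * R) :=
  {within A, continuous phi} /\ {within A, continuous Dphi} /\
  forall x, (interior A) x ->
     differentiable phi x /\ forall y, 'd phi x y = dot2 (Dphi x) y.

Definition V_space (n p : nat) (FL1 FL2 FR1 FR2 : R -> R -> R)
    (phi : R * R -> R) : Prop :=
  (exists f, tspline (-1) n p p.-1 f /\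
     forall u v, -1 <= u <= 0 -> 0 <= v <= 1 -> phi (FL1 u v, FL2 u v) = f u v) /\
  (exists f, tspline 0 n p p.-1 f /\
     forall u v, 0 <= u <= 1 -> 0 <= v <= 1 -> phi (FR1 u v, FR2 u v) = f u v).

Definition Omega (FL1 FL2 FR1 FR2 : R -> R -> R) : set (R * R) :=
  patch_img FL1 FL2 (-1) `|` patch_img FR1 FR2 0.

Definition F0 (FL1 FL2 : R -> R -> R) (v : R) : R * R := (FL1 0 v, FL2 0 v).

Definition dvec (FL1 FL2 : R -> R -> R) (aL bL : {poly R}) (v : R) : R * R :=
  ((du FL1 0 v - bL.[v] * dv FL1 0 v) / aL.[v],
   (du FL2 0 v - bL.[v] * dv FL2 0 v) / aL.[v]).

Definition trace_space (n p : nat) (FL1 FL2 FR1 FR2 : R -> R -> R)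
    (aL bL : {poly R}) (g0 g1 : R -> R) : Prop :=
  exists (phi : R * R -> R) (Dphi : R * R -> R * R),
    V_space n p FL1 FL2 FR1 FR2 phi /\
    C1_on (Omega FL1 FL2 FR1 FR2) phi Dphi /\
    forall v, 0 <= v <= 1 ->
      g0 v = phi (F0 FL1 FL2 v) /\
      g1 v = dot2 (Dphi (F0 FL1 FL2 v)) (dvec FL1 FL2 aL bL v).

Definition lin_space (G : (R -> R) -> Prop) : Prop :=
  G (fun _ => 0) /\ (forall f g, G f -> G g -> G (fun x => f x + g x)) /\
  (forall (c : R) f, G f -> G (fun x => c * f x)).

Definition dim_le01 (G : (R -> R) -> Prop) (C : nat) : Prop :=
  forall (m : nat) (g : 'I_m -> R -> R), (forall i, G (g i)) ->
    (forall c : 'I_m -> R,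
       (forall v, 0 <= v <= 1 -> \sum_(i < m) c i * g i v = 0) ->
       forall i, c i = 0) ->
    (m <= C)%N.

End Defs.

(* Main.v *)
(* Write f for the trace of phi along the interface and g for its transversal
   derivative. The chain rule, together with analysis-suitability, gives
     D_u (phi o F^S)(0, .) = alpha^S g + beta^S f'   for S = L, R,
   and the left-hand sides, like f, are univariate splines. Taking g = 0 (the
   zero function is in G1), beta^S f' must be as smooth as f: the top derivative
   of f cannot jump at a knot unless beta^S vanishes there, which happens at most
   once, so f consists of at most two polynomials. Taking f = 0, both alpha^L g
   and alpha^R g are splines; if alpha^L and alpha^R span {1, v}, so are g and
   v g, hence g has degree less than p and smoothness p - 1 and is a single
   polynomial. The chain rule is only available in the interior of Omega: a
   local open mapping theorem puts the image of each open patch there, and the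
   identity extends to the interface by continuity of the gradient. *)
Require Import Defs.
From HB Require Import structures.
From mathcomp Require Import all_boot all_order all_algebra.
From mathcomp Require Import all_classical all_reals all_analysis.
From mathcomp Require Import ring lra zify.
Import Order.TTheory GRing.Theory Num.Theory.
Import numFieldNormedType.Exports.
Local Open Scope classical_set_scope.
Local Open Scope ring_scope.
Set Implicit Arguments. Unset Strict Implicit. Unset Printing Implicit Defensive.

(** * Continuously differentiable functions of two variables and local openness *)

(** Posed on the whole plane: the canonical extension of a spline is differentiable across the edges
    of the parameter domain, so no one-sided derivatives are needed. *)
Definition C1_fun (R : realType) (F Fu Fv : R -> R -> R) : Prop :=
  [/\ forall u v, is_derive u (1 : R) (fun x : R => F x v) (Fu u v),
      forall u v, is_derive v (1 : R) (F u) (Fv u v),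
      continuous (fun x : R * R => F x.1 x.2),
      continuous (fun x : R * R => Fu x.1 x.2) &
      continuous (fun x : R * R => Fv x.1 x.2)].

(** Locating the mean value point by its distance to [a] spares callers the ordering of the
    endpoints, and keeps the point in any interval centred at [a] that contains [b]. *)
Lemma MVT_unordered (R : realType) (f df : R -> R) (a b : R) :
  (forall x, is_derive x (1 : R) f (df x)) ->
  exists2 c, `|c - a| <= `|b - a| & f b - f a = df c * (b - a).
Proof.
move=> fdf; have cf : continuous f.
  move=> x; apply: differentiable_continuous; apply/derivable1_diffP.
  exact: (@ex_derive _ _ _ _ _ _ _ (fdf x)).
have [ab|/ltW ba] := leP a b.
  have [c cab ->] := MVT_segment ab (fun x _ => fdf x) (continuous_subspaceT cf).
  exists c => //; move: cab; rewrite in_itv/= => /andP[? ?].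
  by rewrite !ger0_norm ?subr_ge0// lerD2r.
have [c cab e] := MVT_segment ba (fun x _ => fdf x) (continuous_subspaceT cf).
exists c; last by rewrite -opprB e; ring.
move: cab; rewrite in_itv/= => /andP[? ?].
by rewrite !ler0_norm ?subr_le0// lerN2 lerD2r.
Qed.

(** The increment is split at the corner [(u0, v)], so the two partial derivatives come out at
    different points. *)
Lemma C1_fun_mvt (R : realType) (F Fu Fv : R -> R -> R) (u v u0 v0 : R) :
  C1_fun F Fu Fv ->
  exists xi eta, [/\ `|xi - u0| <= `|u - u0|, `|eta - v0| <= `|v - v0| &
    F u v - F u0 v0 = Fu xi v * (u - u0) + Fv u0 eta * (v - v0)].
Proof.
case=> dFu dFv _ _ _.
have [xi xiP e1] := @MVT_unordered R (F ^~ v) (Fu ^~ v) u0 u (fun x => dFu x v).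
have [eta etaP e2] := @MVT_unordered R (F u0) (Fv u0) v0 v (dFv u0).
by exists xi, eta; split => //; rewrite -e1 -e2; ring.
Qed.

Lemma linear_system_inj (R : realType) (a b c d x y : R) :
  a * d - b * c != 0 -> a * x + b * y = 0 -> c * x + d * y = 0 -> x = 0 /\ y = 0.
Proof.
move=> D e1 e2.
have ex : (a * d - b * c) * x = d * (a * x + b * y) - b * (c * x + d * y) by ring.
have ey : (a * d - b * c) * y = a * (c * x + d * y) - c * (a * x + b * y) by ring.
move: ex ey; rewrite e1 e2 !mulr0 subrr => /eqP + /eqP.
by rewrite !mulf_eq0 (negbTE D)/= => /eqP -> /eqP ->.
Qed.

(** The determinant is continuous in its four entries. These vary independently because the mean
    value theorem evaluates them at different points. *)
Lemma det_near_neq0 (R : realType) (a b c d : R) : a * d - b * c != 0 ->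
  exists2 e, 0 < e & forall a' b' c' d', `|a - a'| < e -> `|b - b'| < e ->
    `|c - c'| < e -> `|d - d'| < e -> a' * d' - b' * c' != 0.
Proof.
move=> D.
pose f (x : (R * R) * (R * R)) := x.1.1 * x.2.2 - x.1.2 * x.2.1.
have cf : {for ((a, b), (c, d)), continuous f}.
  have c11 : {for ((a, b), (c, d)), continuous (fun x : (R * R) * (R * R) => x.1.1)}.
    by apply: (@continuous_comp _ _ _ fst fst); [exact: cvg_fst|exact: cvg_fst].
  have c12 : {for ((a, b), (c, d)), continuous (fun x : (R * R) * (R * R) => x.1.2)}.
    by apply: (@continuous_comp _ _ _ fst snd); [exact: cvg_fst|exact: cvg_snd].
  have c21 : {for ((a, b), (c, d)), continuous (fun x : (R * R) * (R * R) => x.2.1)}.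
    by apply: (@continuous_comp _ _ _ snd fst); [exact: cvg_snd|exact: cvg_fst].
  have c22 : {for ((a, b), (c, d)), continuous (fun x : (R * R) * (R * R) => x.2.2)}.
    by apply: (@continuous_comp _ _ _ snd snd); [exact: cvg_snd|exact: cvg_snd].
  by apply: cvgB; apply: cvgM.
have : \forall x \near (((a, b), (c, d)) : (R * R) * (R * R)), f x != 0.
  exact: (@cvgr_neq0 R R^o _ _ _ f _ cf).
move=> /nbhs_ballP[e /= e0 ef]; exists e => // a' b' c' d' ha hb hc hd.
by apply: (ef ((a', b'), (c', d'))); split; split.
Qed.

(** This is half the derivative of [f ^+ 2 + g ^+ 2] at an interior minimum. It is applied along
    each coordinate line separately. *)
Lemma sqr_sum_min_critical (R : realType) (f g : R -> R) (x s df dg : R) : 0 < s ->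
  (forall t, derivable f t 1) -> (forall t, derivable g t 1) ->
  is_derive x 1 f df -> is_derive x 1 g dg ->
  (forall t, `|t - x| < s -> f x ^+ 2 + g x ^+ 2 <= f t ^+ 2 + g t ^+ 2) ->
  f x * df + g x * dg = 0.
Proof.
move=> s0 Df Dg dfx dgx xmin.
have : is_derive x 1 (f ^+ 2 + g ^+ 2) 0.
  apply: (@derive1_at_min R _ (x - s) (x + s)); first lra.
  - by move=> t _; apply: derivableD; apply: derivableX; [exact: Df|exact: Dg].
  - by rewrite in_itv/=; lra.
  - move=> t; rewrite in_itv/= => tx; rewrite !fctE; apply: xmin.
    by rewrite ltr_norml; lra.
have : is_derive x 1 (f ^+ 2 + g ^+ 2) (2 * f x * df + 2 * g x * dg).
  apply: (is_derive_eq (is_deriveD (is_deriveX 2 dfx) (is_deriveX 2 dgx))).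
  by rewrite /= !expr1 /GRing.scale.
move=> /@derive_val e1 /@derive_val; rewrite e1; lra.
Qed.

(* A point of a small square minimising |F - y|^2 is interior when y is close to
   F (u0, v0), because F (u0, v0) is at positive distance from the image of the
   boundary; there the gradient vanishes, and invertibility of the Jacobian
   matrix forces F = y. *)
Lemma C1_fun_open_map (R : realType) (F1 F1u F1v F2 F2u F2v : R -> R -> R)
    (U : set (R * R)) (u0 v0 : R) :
  C1_fun F1 F1u F1v -> C1_fun F2 F2u F2v ->
  F1u u0 v0 * F2v u0 v0 - F1v u0 v0 * F2u u0 v0 != 0 ->
  nbhs ((u0, v0) : R * R) U ->
  nbhs ((F1 u0 v0, F2 u0 v0) : R * R) ((fun x => (F1 x.1 x.2, F2 x.1 x.2)) @` U).
Proof.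
move=> C1 C2 J0 Unear.
have [e e0 eP] := det_near_neq0 J0.
have [s s0 sP] : exists2 s, 0 < s & forall u v, `|u - u0| <= s -> `|v - v0| <= s ->
    [/\ U (u, v), `|F1u u0 v0 - F1u u v| < e, `|F1v u0 v0 - F1v u v| < e,
      `|F2u u0 v0 - F2u u v| < e & `|F2v u0 v0 - F2v u v| < e].
  have nearF (G : R -> R -> R) : continuous (fun x : R * R => G x.1 x.2) ->
      \forall x \near ((u0, v0) : R * R), `|G u0 v0 - G x.1 x.2| < e.
    by move=> /(_ (u0, v0)) /cvgrPdist_lt; exact.
  case: C1 C2 => _ _ _ /nearF n1 /nearF n2 [_ _ _ /nearF n3 /nearF n4].
  have /nbhs_ballP[s /= s0 sP] : \forall x \near ((u0, v0) : R * R),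
      [/\ U x, `|F1u u0 v0 - F1u x.1 x.2| < e, `|F1v u0 v0 - F1v x.1 x.2| < e,
        `|F2u u0 v0 - F2u x.1 x.2| < e & `|F2v u0 v0 - F2v x.1 x.2| < e].
    by near=> x; split; near: x.
  (* Halving the radius puts the closed square inside the open ball. *)
  exists (s / 2); first lra.
  move=> u v us vs; have /sP[? ? ? ? ?] : ball ((u0, v0) : R * R) s (u, v).
    by split; rewrite /ball/= distrC; lra.
  by split.
(* Each entry may be taken at its own point, as the mean value theorem requires. *)
have detP u v u' v' u1 v1 u1' v1' :
    `|u - u0| <= s -> `|v - v0| <= s -> `|u' - u0| <= s -> `|v' - v0| <= s ->
    `|u1 - u0| <= s -> `|v1 - v0| <= s -> `|u1' - u0| <= s -> `|v1' - v0| <= s ->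
    F1u u v * F2v u1' v1' - F1v u' v' * F2u u1 v1 != 0.
  move=> h1 h2 h3 h4 h5 h6 h7 h8.
  have [_ ? _ _ _] := sP _ _ h1 h2.
  have [_ _ ? _ _] := sP _ _ h3 h4.
  have [_ _ _ ? _] := sP _ _ h5 h6.
  have [_ _ _ _ ?] := sP _ _ h7 h8.
  exact: eP.
pose N (y x : R * R) : R := (F1 x.1 x.2 - y.1) ^+ 2 + (F2 x.1 x.2 - y.2) ^+ 2.
have cN y : continuous (N y).
  move=> x; case: C1 C2 => _ _ c1 _ _ [_ _ c2 _ _].
  apply: cvgD; apply: cvgM; (apply: cvgB; [by [exact: c1|exact: c2]|exact: cvg_cst]).
pose c : R * R := (F1 u0 v0, F2 u0 v0).
pose K : set (R * R) := `[u0 - s, u0 + s] `*` `[v0 - s, v0 + s].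
have KE u v : K (u, v) <-> `|u - u0| <= s /\ `|v - v0| <= s.
  by rewrite /K/=; split=> [[]|[]]; rewrite /= !in_itv/= !ler_norml; lra.
have cK : compact K by apply: compact_setX; exact: segment_compact.
(* [S] is the boundary of the square [K]. *)
pose S := K `&` [set x : R * R | `|x.1 - u0| = s \/ `|x.2 - v0| = s].
have cS : compact S.
  apply: compact_closedI => //; apply: closedU.
  - apply: (@closed_comp _ _ (fun x : R * R => `|x.1 - u0|) [set s]); last first.
      exact: closed_eq.
    move=> x _; apply: cvg_norm; apply: cvgB; [exact: cvg_fst|exact: cvg_cst].
  - apply: (@closed_comp _ _ (fun x : R * R => `|x.2 - v0|) [set s]); last first.
      exact: closed_eq.
    move=> x _; apply: cvg_norm; apply: cvgB; [exact: cvg_snd|exact: cvg_cst].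
have S0 : S !=set0.
  exists (u0 + s, v0); split; first by apply/KE; rewrite subrr normr0 (addrC u0) addrK ger0_norm; lra.
  by left; rewrite /= (addrC u0) addrK ger0_norm; lra.
have [[um vm] + /= mS] := compact_EVT_min S0 cS (continuous_subspaceT (cN c)).
rewrite inE => -[/KE[umK vmK]] umS.
(* If a boundary point were sent to [c], its offset from [(u0, v0)] would solve a nonsingular
   homogeneous system, by the mean value theorem, and so would be zero. *)
have M0 : 0 < N c (um, vm).
  rewrite lt0r addr_ge0 ?sqr_ge0// andbT paddr_eq0 ?sqr_ge0// !sqrf_eq0.
  apply/negP => /andP[/eqP e1 /eqP e2].
  have [x1 [y1 [hx1 hy1 E1]]] := C1_fun_mvt um vm u0 v0 C1.
  have [x2 [y2 [hx2 hy2 E2]]] := C1_fun_mvt um vm u0 v0 C2.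
  move: e1 e2; rewrite /= E1 E2 => e1 e2.
  have z0 : `|u0 - u0| <= s by rewrite subrr normr0 ltW.
  have z1 : `|v0 - v0| <= s by rewrite subrr normr0 ltW.
  have [|eu ev] := linear_system_inj _ e1 e2.
    by apply: detP => //; [exact: le_trans umK|exact: le_trans vmK|exact: le_trans umK|exact: le_trans vmK].
  move: umS; rewrite /= eu ev normr0 => -[] E; lra.
(* The factor 4: if a minimiser x of |F - y| over [K] lay on the boundary, then |F x - y| <= |c -
   y|, and the parallelogram identity would give |F x - c|^2 <= 2 |F x - y|^2 + 2 |c - y|^2 <= 4 |c
   - y|^2, below the boundary minimum. *)
have nearc : \forall y \near c, 4 * ((F1 u0 v0 - y.1) ^+ 2 + (F2 u0 v0 - y.2) ^+ 2) < N c (um, vm).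
  pose h (y : R * R) : R := 4 * ((F1 u0 v0 - y.1) ^+ 2 + (F2 u0 v0 - y.2) ^+ 2).
  have ch : h y @[y --> c] --> h c.
    apply: cvgM; first exact: cvg_cst.
    by apply: cvgD; apply: cvgM; (apply: cvgB; [exact: cvg_cst|by [exact: cvg_fst|exact: cvg_snd]]).
  apply: (cvgr_lt _ ch).
  by rewrite /h /= !subrr !expr0n/= addr0 mulr0.
apply: filterS nearc => y yc.
have K0 : K !=set0.
  by exists (u0, v0); apply/KE; rewrite !subrr normr0; lra.
have [[u v] + /= mK] := compact_EVT_min K0 cK (continuous_subspaceT (cN y)).
rewrite inE => /KE[uK vK].
have uvi : `|u - u0| < s /\ `|v - v0| < s.
  have [|+ ] := pselect (S (u, v)); last first.
    move=> nS; split; rewrite lt_neqAle ?uK ?vK andbT; apply/eqP => E; apply: nS; split.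
    - by apply/KE.
    - by left.
    - by apply/KE.
    - by right.
  move=> /mem_set /mS H; exfalso.
  have : N y (u, v) <= N y (u0, v0).
    by apply: mK; rewrite inE; apply/KE; rewrite !subrr normr0; lra.
  move: H yc; rewrite /N /=.
  move: (F1 u v) (F2 u v) (F1 u0 v0) (F2 u0 v0) (F1 um vm) (F2 um vm) => a1 a2 c1 c2 d1 d2 H1 H2 H3.
  have : 0 <= (a1 - y.1 + (c1 - y.1)) ^+ 2 by exact: sqr_ge0.
  have : 0 <= (a2 - y.2 + (c2 - y.2)) ^+ 2 by exact: sqr_ge0.
  nra.
have [us vs] := uvi.
have crit_u : (F1 u v - y.1) * F1u u v + (F2 u v - y.2) * F2u u v = 0.
  case: C1 C2 => d1 _ _ _ _ [d2 _ _ _ _].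
  have D1 t : is_derive t (1 : R) (fun x => F1 x v - y.1) (F1u t v).
    by apply: is_derive_eq; rewrite subr0.
  have D2 t : is_derive t (1 : R) (fun x => F2 x v - y.2) (F2u t v).
    by apply: is_derive_eq; rewrite subr0.
  apply: (@sqr_sum_min_critical _ (fun x => F1 x v - y.1) (fun x => F2 x v - y.2) u (s - `|u - u0|)) => //.
  - by rewrite subr_gt0.
  - move=> t tu; apply: (mK (t, v)); rewrite inE; apply/KE; split=> //.
    by have := ler_distD u t u0; lra.
have crit_v : (F1 u v - y.1) * F1v u v + (F2 u v - y.2) * F2v u v = 0.
  case: C1 C2 => _ d1 _ _ _ [_ d2 _ _ _].
  have D1 t : is_derive t (1 : R) (fun x => F1 u x - y.1) (F1v u t).
    by apply: is_derive_eq; rewrite subr0.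
  have D2 t : is_derive t (1 : R) (fun x => F2 u x - y.2) (F2v u t).
    by apply: is_derive_eq; rewrite subr0.
  apply: (@sqr_sum_min_critical _ (fun x => F1 u x - y.1) (fun x => F2 u x - y.2) v (s - `|v - v0|)) => //.
  - by rewrite subr_gt0.
  - move=> t tu; apply: (mK (u, t)); rewrite inE; apply/KE; split=> //.
    by have := ler_distD v t v0; lra.
exists (u, v); first by have [] := sP u v uK vK.
(* The two critical equations say that the transposed Jacobian matrix annihilates F (u, v) - y. *)
have D : F1u u v * F2v u v - F2u u v * F1v u v != 0.
  by rewrite [F2u u v * _]mulrC; exact: detP.
have [E1 E2] : F1 u v - y.1 = 0 /\ F2 u v - y.2 = 0; last first.
  by rewrite [y]surjective_pairing /=; congr pair; lra.
apply: (linear_system_inj D).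
- by rewrite ![F1u _ _ * _]mulrC ![F2u _ _ * _]mulrC.
- by rewrite ![F1v _ _ * _]mulrC ![F2v _ _ * _]mulrC.
Unshelve. all: by end_near. Qed.

(** * The chain rule up to the boundary of a patch *)

Lemma is_derive_comp_pair (R : realType) (phi : R * R -> R) (g1 g2 : R -> R)
    (x d1 d2 : R) (D : R * R) :
  is_derive x 1 g1 d1 -> is_derive x 1 g2 d2 ->
  differentiable phi (g1 x, g2 x) ->
  (forall y, 'd phi (g1 x, g2 x) y = dot2 D y) ->
  is_derive x 1 (fun t => phi (g1 t, g2 t)) (dot2 D (d1, d2)).
Proof.
move=> Dg1 Dg2 dphi dphiE.
have dg1 : differentiable g1 x by apply/derivable1_diffP; exact: (@ex_derive _ _ _ _ _ _ _ Dg1).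
have dg2 : differentiable g2 x by apply/derivable1_diffP; exact: (@ex_derive _ _ _ _ _ _ _ Dg2).
have dg := differentiable_pair dg1 dg2.
have dc : differentiable (phi \o (fun t => (g1 t, g2 t))) x by exact: differentiable_comp.
apply: DeriveDef; first by apply/derivable1_diffP.
rewrite (deriveE (1 : R) dc) diff_comp//= dphiE diff_pair//=.
by rewrite -!deriveE// !derive_val.
Qed.

(** Continuity within [A] controls only points of [A]. The path is known to stay there for
    parameters in [0, 1], hence a right limit at 0. *)
Lemma within_path_cvg (R : realType) (T : topologicalType) (A : set (R * R))
    (G : R * R -> T) (g1 g2 : R -> R) :
  {within A, continuous G} -> continuous g1 -> continuous g2 ->
  (forall t, 0 <= t <= 1 -> A (g1 t, g2 t)) ->
  G (g1 t, g2 t) @[t --> 0^'+] --> G (g1 0, g2 0).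
Proof.
move=> /subspace_continuousP cG c1 c2 Ag.
have A0 : A (g1 0, g2 0) by apply: Ag; rewrite lexx ler01.
move=> B /(cG _ A0) /= nB.
have cg : (g1 t, g2 t) @[t --> 0^'+] --> ((g1 0, g2 0) : R * R).
  by apply: (@cvg_pair _ _ _ (0^'+) (nbhs (g1 0)) (nbhs (g2 0)));
    apply: cvg_at_right_filter; [exact: c1|exact: c2].
have H : \forall t \near 0^'+, A (g1 t, g2 t) -> B (G (g1 t, g2 t)) := cg _ nB.
change (\forall t \near 0^'+, B (G (g1 t, g2 t))).
near=> t; have : A (g1 t, g2 t) -> B (G (g1 t, g2 t)) by near: t.
by apply; apply: Ag; apply/andP; split; near: t; [exact: nbhs_right_ge|exact: nbhs_right_ltW].
Unshelve. all: by end_near. Qed.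

Lemma C1_on_chain_rule (R : realType) (a b c d : R)
    (F1 F1u F1v F2 F2u F2v f fu fv : R -> R -> R) (A : set (R * R))
    (phi : R * R -> R) (Dphi : R * R -> R * R) :
  a < b -> c < d ->
  C1_fun F1 F1u F1v -> C1_fun F2 F2u F2v -> C1_fun f fu fv ->
  (forall u v, a <= u <= b -> c <= v <= d -> A (F1 u v, F2 u v)) ->
  (forall u v, a <= u <= b -> c <= v <= d -> phi (F1 u v, F2 u v) = f u v) ->
  (forall u v, a <= u <= b -> c <= v <= d ->
    F1u u v * F2v u v - F1v u v * F2u u v != 0) ->
  C1_on A phi Dphi ->
  forall u v, a <= u <= b -> c <= v <= d ->
    fu u v = dot2 (Dphi (F1 u v, F2 u v)) (F1u u v, F2u u v) /\
    fv u v = dot2 (Dphi (F1 u v, F2 u v)) (F1v u v, F2v u v).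
Proof.
move=> ab cd C1 C2 Cf FA phif J [_ [cD dphi]].
have op u v : a < u < b -> c < v < d ->
    fu u v = dot2 (Dphi (F1 u v, F2 u v)) (F1u u v, F2u u v) /\
    fv u v = dot2 (Dphi (F1 u v, F2 u v)) (F1v u v, F2v u v).
  move=> /andP[au ub] /andP[cv vd].
  have nu : \forall t \near u, a <= t <= b.
    near=> t; suff : t \in `]a, b[ by rewrite in_itv/= => /andP[? ?]; rewrite !ltW.
    by near: t; apply: near_in_itvoo; rewrite in_itv/=; apply/andP.
  have nv : \forall t \near v, c <= t <= d.
    near=> t; suff : t \in `]c, d[ by rewrite in_itv/= => /andP[? ?]; rewrite !ltW.
    by near: t; apply: near_in_itvoo; rewrite in_itv/=; apply/andP.
  have iA : (interior A) (F1 u v, F2 u v).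
    have nU : nbhs ((u, v) : R * R) [set x : R * R | a <= x.1 <= b /\ c <= x.2 <= d].
      by exists ([set t | a <= t <= b], [set t | c <= t <= d]) => //= x [].
    have J0 : F1u u v * F2v u v - F1v u v * F2u u v != 0 by apply: J; rewrite !ltW.
    apply: filterS (C1_fun_open_map C1 C2 J0 nU) => _ [x [hx1 hx2] <-].
    exact: FA.
  have [dif difE] := dphi _ iA.
  case: C1 C2 Cf => d1u d1v _ _ _ [d2u d2v _ _ _] [dfu dfv _ _ _].
  have E1 := is_derive_comp_pair (d1u u v) (d2u u v) dif difE.
  have E2 := is_derive_comp_pair (d1v u v) (d2v u v) dif difE.
  have E1' : is_derive u (1 : R) (fun t => f t v) (dot2 (Dphi (F1 u v, F2 u v)) (F1u u v, F2u u v)).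
    apply: near_eq_is_derive E1; near=> t; apply: phif; last by rewrite !ltW.
    by near: t.
  have E2' : is_derive v (1 : R) (f u) (dot2 (Dphi (F1 u v, F2 u v)) (F1v u v, F2v u v)).
    apply: near_eq_is_derive E2; near=> t; apply: phif; first by rewrite !ltW.
    by near: t.
  split.
    by have := dfu u v => /@derive_val <-; have := E1' => /@derive_val <-.
  by have := dfv u v => /@derive_val <-; have := E2' => /@derive_val <-.
move=> u v uab vcd.
(* The segment from [(u, v)] to the centre of the rectangle lies in the open rectangle except
   possibly at its start, so the identity known there passes to [(u, v)] in the limit. *)
pose g1 t := u + t * ((a + b) / 2 - u).
pose g2 t := v + t * ((c + d) / 2 - v).
have g10 : g1 0 = u by rewrite /g1 mul0r addr0.
have g20 : g2 0 = v by rewrite /g2 mul0r addr0.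
have cg1 : continuous g1.
  by move=> t; apply: cvgD; [exact: cvg_cst|apply: cvgM; [exact: cvg_id|exact: cvg_cst]].
have cg2 : continuous g2.
  by move=> t; apply: cvgD; [exact: cvg_cst|apply: cvgM; [exact: cvg_id|exact: cvg_cst]].
have g1in t : 0 < t <= 1 -> a < g1 t < b.
  by move=> /andP[? ?]; move: uab => /andP[? ?]; rewrite /g1; apply/andP; split; nra.
have g2in t : 0 < t <= 1 -> c < g2 t < d.
  by move=> /andP[? ?]; move: vcd => /andP[? ?]; rewrite /g2; apply/andP; split; nra.
have g1in' t : 0 <= t <= 1 -> a <= g1 t <= b.
  move=> /andP[]; rewrite le_eqVlt => /predU1P[<-|t0 t1]; first by rewrite g10.
  by have /andP[? ?] := g1in t (introT andP (conj t0 t1)); rewrite !ltW.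
have g2in' t : 0 <= t <= 1 -> c <= g2 t <= d.
  move=> /andP[]; rewrite le_eqVlt => /predU1P[<-|t0 t1]; first by rewrite g20.
  by have /andP[? ?] := g2in t (introT andP (conj t0 t1)); rewrite !ltW.
have cvg2 (G : R -> R -> R) : continuous (fun x : R * R => G x.1 x.2) ->
    G (g1 t) (g2 t) @[t --> 0^'+] --> G u v.
  move=> cG.
  have := @within_path_cvg R R setT (fun x : R * R => G x.1 x.2) g1 g2.
  by rewrite /= g10 g20; apply=> //; exact: continuous_subspaceT.
have [c1 c1u c1v] : [/\ continuous (fun x : R * R => F1 x.1 x.2),
  continuous (fun x : R * R => F1u x.1 x.2) & continuous (fun x : R * R => F1v x.1 x.2)].
  by case: C1.
have [c2 c2u c2v] : [/\ continuous (fun x : R * R => F2 x.1 x.2),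
  continuous (fun x : R * R => F2u x.1 x.2) & continuous (fun x : R * R => F2v x.1 x.2)].
  by case: C2.
have [cfu cfv] : continuous (fun x : R * R => fu x.1 x.2) /\
    continuous (fun x : R * R => fv x.1 x.2) by case: Cf.
have cpath (G : R -> R -> R) : continuous (fun x : R * R => G x.1 x.2) ->
    continuous (fun t => G (g1 t) (g2 t)).
  move=> cG t; apply: (@continuous_comp _ _ _ (fun t => (g1 t, g2 t)) (fun x : R * R => G x.1 x.2)).
    by apply: (@cvg_pair _ _ _ (nbhs t) (nbhs (g1 t)) (nbhs (g2 t))); [exact: cg1|exact: cg2].
  exact: cG.
have cDF : Dphi (F1 (g1 t) (g2 t), F2 (g1 t) (g2 t)) @[t --> 0^'+] --> Dphi (F1 u v, F2 u v).
  have := within_path_cvg cD (cpath _ c1) (cpath _ c2).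
  rewrite g10 g20; apply=> t t01.
  by apply: FA; [exact: g1in'|exact: g2in'].
have cDF1 : (Dphi (F1 (g1 t) (g2 t), F2 (g1 t) (g2 t))).1 @[t --> 0^'+] --> (Dphi (F1 u v, F2 u v)).1.
  by apply: cvg_comp cDF _; exact: cvg_fst.
have cDF2 : (Dphi (F1 (g1 t) (g2 t), F2 (g1 t) (g2 t))).2 @[t --> 0^'+] --> (Dphi (F1 u v, F2 u v)).2.
  by apply: cvg_comp cDF _; exact: cvg_snd.
have t01 : \forall t \near 0^'+, (0 : R) < t <= 1.
  near=> t; apply/andP; split; near: t; [exact: nbhs_right_gt|exact: (nbhs_right_ltW ltr01)].
have lim_eq (G H1 H2 : R -> R -> R) : continuous (fun x : R * R => G x.1 x.2) ->
    continuous (fun x : R * R => H1 x.1 x.2) -> continuous (fun x : R * R => H2 x.1 x.2) ->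
    (forall u v, a < u < b -> c < v < d -> G u v = dot2 (Dphi (F1 u v, F2 u v)) (H1 u v, H2 u v)) ->
    G u v = dot2 (Dphi (F1 u v, F2 u v)) (H1 u v, H2 u v).
  move=> /cvg2 cG /cvg2 cH1 /cvg2 cH2 GE.
  have cR : dot2 (Dphi (F1 (g1 t) (g2 t), F2 (g1 t) (g2 t))) (H1 (g1 t) (g2 t), H2 (g1 t) (g2 t))
      @[t --> 0^'+] --> dot2 (Dphi (F1 u v, F2 u v)) (H1 u v, H2 u v).
    by apply: cvgD; apply: cvgM.
  have E : {near 0^'+, (fun t => G (g1 t) (g2 t)) =1
      (fun t => dot2 (Dphi (F1 (g1 t) (g2 t), F2 (g1 t) (g2 t)))
        (H1 (g1 t) (g2 t), H2 (g1 t) (g2 t)))}.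
    by near=> t; apply: GE; [apply: g1in|apply: g2in]; near: t; exact: t01.
  have cG' : dot2 (Dphi (F1 (g1 t) (g2 t), F2 (g1 t) (g2 t)))
      (H1 (g1 t) (g2 t), H2 (g1 t) (g2 t)) @[t --> 0^'+] --> G u v.
    exact: (cvg_trans (near_eq_cvg E) cG).
  exact: (cvg_unique (@Rhausdorff R) cG' cR).
by split; apply: lim_eq => // u' v' hu hv; have [] := op u' v' hu hv.
Unshelve. all: by end_near. Qed.

(** * Uniform knots and functions defined piecewise on cells *)

Lemma filter_forall_lt (T : Type) (F : set_system T) (n : nat) (P : nat -> T -> Prop) :
  Filter F -> (forall i, (i < n)%N -> \forall x \near F, P i x) ->
  \forall x \near F, forall i, (i < n)%N -> P i x.
Proof.
move=> FF; elim: n => [_|n IH nP]; first exact: nearW.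
have n1 := nP n (ltnSn n).
have n2 := IH (fun i ilt => nP i (ltnW ilt)).
apply: filterS2 n1 n2 => x P1 P2 i; rewrite ltnS leq_eqVlt => /predU1P[->//|]; exact: P2.
Qed.

Definition knot (R : realType) (a : R) (n i : nat) : R := a + i%:R / n%:R.

(* The first and last cells are unbounded, so that the cells cover the line. *)
Definition cell (R : realType) (a : R) (n i : nat) (x : R) : Prop :=
  ((0 < i)%N -> knot a n i <= x) /\ ((i.+1 < n)%N -> x <= knot a n i.+1).

Lemma knot_lt (R : realType) (a : R) n i j : (0 < n)%N ->
  (knot a n i < knot a n j) = (i < j)%N.
Proof. by move=> n0; rewrite /knot ltrD2l ltr_pM2r ?invr_gt0 ?ltr0n// ltr_nat. Qed.

Lemma knot_le (R : realType) (a : R) n i j : (0 < n)%N ->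
  (knot a n i <= knot a n j) = (i <= j)%N.
Proof. by move=> n0; rewrite leNgt knot_lt// -leqNgt. Qed.

Lemma knot0 (R : realType) (a : R) n : knot a n 0 = a.
Proof. by rewrite /knot mul0r addr0. Qed.

Lemma knotn (R : realType) (a : R) n : (0 < n)%N -> knot a n n = a + 1.
Proof. by move=> n0; rewrite /knot divff// pnatr_eq0 -lt0n. Qed.

Lemma cell_itv (R : realType) (a x : R) n i : (0 < n)%N -> a <= x <= a + 1 ->
  (i < n)%N -> cell a n i x -> knot a n i <= x <= knot a n i.+1.
Proof.
move=> n0 /andP[ax xa] ilt [h1 h2]; apply/andP; split.
  by case: i ilt h1 {h2} => [_ _|i _]; [rewrite knot0|exact].
move: ilt; rewrite leq_eqVlt => /predU1P[e|//].
by rewrite e knotn.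
Qed.

Lemma itv_cell (R : realType) (a x : R) n i :
  knot a n i <= x <= knot a n i.+1 -> cell a n i x.
Proof. by move=> /andP[? ?]; split. Qed.

Lemma cell_cover (R : realType) (a x : R) n : (0 < n)%N ->
  exists2 i, (i < n)%N & cell a n i x.
Proof.
case: n => // n _.
(* Induction on the number of cells, the last one being unbounded on the right: knot [m.+1] splits
   it in two. *)
have H m : exists2 j, (j <= m)%N &
    ((0 < j)%N -> knot a n.+1 j <= x) /\ ((j < m)%N -> x <= knot a n.+1 j.+1).
  elim: m => [|m [j jm [h1 h2]]]; first by exists 0%N.
  have [le|lt] := leP (knot a n.+1 m.+1) x; first by exists m.+1 => //; split; rewrite // ltnn.
  exists j; first exact: leqW.
  split=> // _; move: jm; rewrite leq_eqVlt => /predU1P[->|]; [exact: ltW|exact: h2].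
by have [j jn] := H n; exists j.
Qed.

(* Near [x] there are only the cells that contain [x], so local properties of a
   piecewise function can be checked on the pieces without one-sided limits. *)
Lemma near_cell (R : realType) (a x : R) n :
  \forall y \near x, forall i, (i < n)%N -> cell a n i y -> cell a n i x.
Proof.
apply: (@filter_forall_lt R (nbhs x) n (fun i y => cell a n i y -> cell a n i x)) => i _.
have [cx|ncx] := pselect (cell a n i x); first exact: nearW.
have [/andP[i0 lt]|h1] := boolP ((0 < i)%N && (x < knot a n i)).
  near=> y; move=> [/(_ i0) + _] => le.
  suff : y < knot a n i by rewrite ltNge le.
  by near: y; exact: (cvgr_lt _ cvg_id).
have [/andP[i0 lt]|h2] := boolP ((i.+1 < n)%N && (knot a n i.+1 < x)).
  near=> y; move=> [_ /(_ i0)] => le.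
  suff : knot a n i.+1 < y by rewrite ltNge le.
  by near: y; exact: (cvgr_gt _ cvg_id).
exfalso; apply: ncx; split=> i0; rewrite leNgt; apply/negP => lt.
  by move: h1; rewrite i0 lt.
by move: h2; rewrite i0 lt.
Unshelve. all: by end_near. Qed.

(** Every y near x lies in a cell that also contains x, and the finitely many pieces of such cells
    all tend to [l]. *)
Lemma piecewise_cvg (R : realType) (a x l : R) n (f : R -> R) (g : nat -> R -> R) :
  (0 < n)%N -> (forall i y, (i < n)%N -> cell a n i y -> f y = g i y) ->
  (forall i, (i < n)%N -> cell a n i x -> g i y @[y --> x] --> l) ->
  f y @[y --> x] --> l.
Proof.
move=> n0 fg gl; apply/cvgrPdist_lt => e e0.
have H : \forall y \near x, forall i, (i < n)%N -> cell a n i x -> `|l - g i y| < e.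
  apply: (@filter_forall_lt R (nbhs x) n (fun i y => cell a n i x -> `|l - g i y| < e)) => i ilt.
  have [cx|ncx] := pselect (cell a n i x); last exact: nearW.
  by have /cvgrPdist_lt/(_ e e0) := gl i ilt cx; apply: filterS.
near=> y; have [i ilt cy] := cell_cover a y n0.
rewrite (fg i y ilt cy); have cx : cell a n i x.
  by move: i ilt cy; near: y; exact: near_cell.
by move: i ilt cx {cy}; near: y.
Unshelve. all: by end_near. Qed.

(** The same argument for difference quotients: a nearby point and x share a cell, so the quotient
    of [f] is that of a single piece. *)
Lemma piecewise_is_derive (R : realType) (a x d : R) n (f : R -> R) (g : nat -> R -> R) :
  (0 < n)%N -> (forall i y, (i < n)%N -> cell a n i y -> f y = g i y) ->
  (forall i, (i < n)%N -> cell a n i x -> is_derive x 1 (g i) d) ->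
  is_derive x 1 f d.
Proof.
move=> n0 fg gd.
suff H : (h^-1 *: ((f \o shift x) (h *: 1) - f x)) @[h --> (0 : R)^'] --> d.
  by apply: DeriveDef; [apply/cvg_ex; exists d|exact: cvg_lim].
apply/cvgrPdist_lt => e e0.
have H : \forall h \near (0 : R)^', forall i, (i < n)%N -> cell a n i x ->
    `|d - h^-1 *: ((g i \o shift x) (h *: 1) - g i x)| < e.
  apply: (@filter_forall_lt R _ n (fun i h => cell a n i x ->
    `|d - h^-1 *: ((g i \o shift x) (h *: 1) - g i x)| < e)) => i ilt.
  have [cx|ncx] := pselect (cell a n i x); last exact: nearW.
  have gi := gd i ilt cx.
  have cg : (h^-1 *: ((g i \o shift x) (h *: 1) - g i x)) @[h --> (0 : R)^'] --> d.
    by rewrite -(@derive_val _ _ _ _ _ _ _ gi); exact: (@ex_derive _ _ _ _ _ _ _ gi).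
  by move/cvgrPdist_lt : cg => /(_ e e0); apply: filterS.
have H2 : \forall h \near (0 : R)^', forall i, (i < n)%N -> cell a n i (h + x) -> cell a n i x.
  have sx : h + x @[h --> (0 : R)^'] --> x.
    have c : h + x @[h --> (0 : R)] --> x.
      by rewrite -{2}[x]add0r; apply: cvgD; [exact: cvg_id|exact: cvg_cst].
    by apply: cvg_trans c; apply: cvg_app; exact: cvg_within.
  exact: sx _ (near_cell a x n).
near=> h; have [i ilt cy] := cell_cover a (h + x) n0.
have cx : cell a n i x.
  by move: i ilt cy; near: h.
have E : (f \o shift x) (h *: 1) = (g i \o shift x) (h *: 1).
  by rewrite /= [h *: 1]mulr1; exact: fg.
rewrite E (fg i x ilt cx); move: i ilt cx {cy E}; near: h; exact: H.
Unshelve. all: by end_near. Qed.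

(** * Univariate and tensor-product splines *)

Definition spline_pieces (R : realType) (a : R) (n q s : nat) (P : nat -> {poly R}) : Prop :=
  (forall i, (size (P i) <= q.+1)%N) /\
  (forall i k, (0 < i < n)%N -> (k <= s)%N ->
    (P i.-1)^`(k).[knot a n i] = (P i)^`(k).[knot a n i]).

(** The unbounded end cells absorb the two extension clauses of [spline], leaving one uniform
    clause. *)
Lemma spline_cellE (R : realType) (a : R) n q s (f : R -> R) : (0 < n)%N ->
  spline a n q s f <-> exists2 P, spline_pieces a n q s P &
    forall i x, (i < n)%N -> cell a n i x -> f x = (P i).[x].
Proof.
move=> n0; split=> [[P [sP [mP [fP [fl fr]]]]]|[P [sP mP] fP]].
  exists P; first by split.
  move=> i x ilt cx.
  have [xa0|ax] := leP x a.
    rewrite fl//; case: i ilt cx => // i ilt [/(_ isT) le _].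
    by have := le_trans le xa0; rewrite -[X in _ <= X](knot0 a n) knot_le.
  have [xa|xa] := leP (a + 1) x.
    rewrite fr//; case: cx => _ h; have [lt|ge] := ltnP i.+1 n.
      by have := le_trans xa (h lt); rewrite -(knotn a n0) knot_le// leqNgt lt.
    by congr ((P _).[_]); lia.
  by apply: fP => //; apply: cell_itv; rewrite ?ltW.
exists P; split=> //; split=> //; split.
  by move=> i x ilt xi; apply: fP => //; exact: itv_cell.
split=> x xa; apply: fP; rewrite ?prednK//; split.
- by rewrite ltnn.
- by move=> n1; rewrite (le_trans xa)// -[X in X <= _](knot0 a n) knot_le.
- by move=> n1; rewrite (le_trans _ xa)// -(knotn a n0) knot_le// leq_pred.
- by rewrite prednK// ltnn.
Qed.

(** Two distinct cells with a common point are adjacent, and the point is the knot between them. *)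
Lemma spline_pieces_match (R : realType) (a x : R) n q s (P : nat -> {poly R}) i j k :
  (0 < n)%N -> spline_pieces a n q s P -> (i < n)%N -> (j < n)%N ->
  cell a n i x -> cell a n j x -> (k <= s)%N -> (P i)^`(k).[x] = (P j)^`(k).[x].
Proof.
move=> n0 [_ mP] + + + + ks; wlog ij : i j / (i < j)%N.
  move=> H ilt jlt ci cj; have [ij|ji|->//] := ltngtP i j; first exact: H.
  by apply/esym; exact: H.
move=> ilt jlt [_ ci] [cj _].
have h1 : knot a n j <= x by apply: cj; lia.
have h2 : x <= knot a n i.+1 by apply: ci; lia.
have := le_trans h1 h2; rewrite knot_le// => ji.
have e : j = i.+1 by lia.
have -> : x = knot a n j by apply/eqP; rewrite eq_le h1 e h2.
by rewrite -mP ?e//; lia.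
Qed.

(** With [0 < s] the pieces meeting at x have equal slopes there, so any cell containing x yields
    the derivative. *)
Lemma spline_is_derive_cell (R : realType) (a x : R) n q s (P : nat -> {poly R}) (f : R -> R) i :
  (0 < n)%N -> (0 < s)%N -> spline_pieces a n q s P ->
  (forall i x, (i < n)%N -> cell a n i x -> f x = (P i).[x]) ->
  (i < n)%N -> cell a n i x -> is_derive x 1 f (P i)^`().[x].
Proof.
move=> n0 s0 pP fP ilt ci.
apply: (piecewise_is_derive n0 fP) => j jlt cj.
have := spline_pieces_match n0 pP ilt jlt ci cj s0; rewrite !derivn1 => ->.
exact: is_derive_poly.
Qed.

Lemma spline_derive1_cell (R : realType) (a x : R) n q s (P : nat -> {poly R}) (f : R -> R) i :
  (0 < n)%N -> (0 < s)%N -> spline_pieces a n q s P ->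
  (forall i x, (i < n)%N -> cell a n i x -> f x = (P i).[x]) ->
  (i < n)%N -> cell a n i x -> derive1 f x = (P i)^`().[x].
Proof.
move=> n0 s0 pP fP ilt ci; rewrite derive1E.
exact: (@derive_val _ _ _ _ _ _ _ (spline_is_derive_cell n0 s0 pP fP ilt ci)).
Qed.

Lemma spline_derivable (R : realType) (a x : R) n q s (f : R -> R) :
  (0 < n)%N -> (0 < s)%N -> spline a n q s f -> is_derive x 1 f (derive1 f x).
Proof.
move=> n0 s0 /(spline_cellE _ _ _ _ n0)[P pP fP].
have [i ilt ci] := cell_cover a x n0.
rewrite (spline_derive1_cell n0 s0 pP fP ilt ci); exact: (spline_is_derive_cell n0 s0 pP fP ilt ci).
Qed.

Lemma spline_continuous (R : realType) (a : R) n q s (f : R -> R) :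
  (0 < n)%N -> (0 < s)%N -> spline a n q s f -> continuous f.
Proof.
move=> n0 s0 sf x; apply: differentiable_continuous; apply/derivable1_diffP.
exact: (@ex_derive _ _ _ _ _ _ _ (spline_derivable x n0 s0 sf)).
Qed.

Lemma spline_continuous_derive1 (R : realType) (a : R) n q s (f : R -> R) :
  (0 < n)%N -> (0 < s)%N -> spline a n q s f -> continuous (derive1 f).
Proof.
move=> n0 s0 /(spline_cellE _ _ _ _ n0)[P pP fP] x.
apply: (@piecewise_cvg _ a _ _ n _ (fun i y => (P i)^`().[y])) => //.
  by move=> i y ilt ci; exact: (spline_derive1_cell n0 s0 pP fP).
by move=> i ilt ci; rewrite (spline_derive1_cell n0 s0 pP fP ilt ci); exact: continuous_horner.
Qed.

Lemma spline_scaleD (R : realType) (a c : R) n q s (f g : R -> R) : (0 < n)%N ->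
  spline a n q s f -> spline a n q s g -> spline a n q s (fun x => f x + c * g x).
Proof.
move=> n0 /(spline_cellE _ _ _ _ n0)[P [sP mP] fP] /(spline_cellE _ _ _ _ n0)[Q [sQ mQ] gQ].
apply/(spline_cellE _ _ _ _ n0); exists (fun i => P i + c *: Q i); first split.
- move=> i; rewrite (leq_trans (size_polyD _ _))// geq_max sP/=.
  by rewrite (leq_trans (size_scale_leq _ _)).
- by move=> i k hi hk; rewrite !derivnD !derivnZ !hornerE mP// mQ.
- by move=> i x hi cx; rewrite !hornerE (fP i)// (gQ i).
Qed.

Lemma spline0 (R : realType) (a : R) n q s : (0 < n)%N -> spline a n q s (fun=> 0).
Proof.
move=> n0; apply/(spline_cellE _ _ _ _ n0); exists (fun=> 0); first split => //.
- by move=> i; rewrite size_poly0.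
- by move=> i x _ _; rewrite horner0.
Qed.

Lemma spline_sum (R : realType) (a : R) n q s m (c : nat -> R) (B : nat -> R -> R) :
  (0 < n)%N -> (forall k, spline a n q s (B k)) ->
  spline a n q s (fun x => \sum_(k < m) c k * B k x).
Proof.
move=> n0 sB; elim: m => [|m IH].
  by under eq_fun do rewrite big_ord0; exact: spline0.
under eq_fun do rewrite big_ord_recr/=.
exact: spline_scaleD.
Qed.

Lemma tspline_duE (R : realType) (a : R) n q s m (A B : nat -> R -> R) (F : R -> R -> R) :
  (0 < n)%N -> (0 < s)%N -> (forall k, spline a n q s (A k)) ->
  (forall u v, F u v = \sum_(k < m) A k u * B k v) ->
  forall u v, is_derive u (1 : R) (fun x => F x v) (\sum_(k < m) derive1 (A k) u * B k v).
Proof.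
move=> n0 s0 sA FE u v.
have -> : (fun x => F x v) = \sum_(k < m) (B k v *: A k).
  apply/funext => x; rewrite FE fct_sumE; apply: eq_bigr => k _; exact: mulrC.
have -> : \sum_(k < m) derive1 (A k) u * B k v = \sum_(k < m) B k v *: derive1 (A k) u.
  by apply: eq_bigr => k _; exact: mulrC.
apply: is_derive_sum => k; apply: is_deriveZ; exact: (spline_derivable u n0 s0 (sA k)).
Qed.

Lemma tspline_dvE (R : realType) n q s m (A B : nat -> R -> R) (F : R -> R -> R) :
  (0 < n)%N -> (0 < s)%N -> (forall k, spline 0 n q s (B k)) ->
  (forall u v, F u v = \sum_(k < m) A k u * B k v) ->
  forall u v, is_derive v (1 : R) (F u) (\sum_(k < m) A k u * derive1 (B k) v).
Proof.
move=> n0 s0 sB FE u v.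
have -> : F u = \sum_(k < m) (A k u *: B k).
  by apply/funext => x; rewrite FE fct_sumE.
apply: is_derive_sum => k; apply: is_deriveZ; exact: (spline_derivable v n0 s0 (sB k)).
Qed.

Lemma continuous_tensor_sum (R : realType) m (A B : nat -> R -> R) :
  (forall k, continuous (A k)) -> (forall k, continuous (B k)) ->
  continuous (fun x : R * R => \sum_(k < m) A k x.1 * B k x.2).
Proof.
move=> cA cB x; elim: m => [|m IH].
  by under eq_fun do rewrite big_ord0; exact: cvg_cst.
under eq_fun do rewrite big_ord_recr/=.
apply: cvgD => //; apply: cvgM.
  by apply: (@continuous_comp _ _ _ fst (A m)); [exact: cvg_fst|exact: cA].
by apply: (@continuous_comp _ _ _ snd (B m)); [exact: cvg_snd|exact: cB].
Qed.

Lemma tspline_C1_fun (R : realType) (a : R) n q s (F : R -> R -> R) :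
  (0 < n)%N -> (0 < s)%N -> tspline a n q s F -> C1_fun F (du F) (dv F).
Proof.
move=> n0 s0 [m [A [B [sA [sB FE]]]]].
have duE := tspline_duE n0 s0 sA FE.
have dvE := tspline_dvE n0 s0 sB FE.
have duE' : du F = fun u v => \sum_(k < m) derive1 (A k) u * B k v.
  apply/funext => u; apply/funext => v; rewrite /du derive1E.
  exact: (@derive_val _ _ _ _ _ _ _ (duE u v)).
have dvE' : dv F = fun u v => \sum_(k < m) A k u * derive1 (B k) v.
  apply/funext => u; apply/funext => v; rewrite /dv derive1E.
  exact: (@derive_val _ _ _ _ _ _ _ (dvE u v)).
have cA k := spline_continuous n0 s0 (sA k).
have cB k := spline_continuous n0 s0 (sB k).
have cA' k := spline_continuous_derive1 n0 s0 (sA k).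
have cB' k := spline_continuous_derive1 n0 s0 (sB k).
rewrite duE' dvE'; split=> //.
- rewrite (_ : (fun x => _) = fun x : R * R => \sum_(k < m) A k x.1 * B k x.2).
    exact: continuous_tensor_sum.
  by apply/funext => x; rewrite FE.
- exact: (@continuous_tensor_sum _ m (fun k => derive1 (A k)) B cA' cB).
- exact: (@continuous_tensor_sum _ m A (fun k => derive1 (B k)) cA cB').
Qed.

Lemma tspline_spline (R : realType) (a u : R) n q s (F : R -> R -> R) :
  (0 < n)%N -> tspline a n q s F -> spline 0 n q s (F u).
Proof.
move=> n0 [m [A [B [sA [sB FE]]]]]; rewrite (_ : F u = fun v => \sum_(k < m) A k u * B k v).
  exact: (spline_sum m (fun k => A k u) n0 sB).
by apply/funext => v.
Qed.

(** Differentiating in u alters only the coefficients of the factors [B k], so no smoothness in v is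
    lost. *)
Lemma tspline_du_spline (R : realType) (a u : R) n q s (F : R -> R -> R) :
  (0 < n)%N -> (0 < s)%N -> tspline a n q s F -> spline 0 n q s (du F u).
Proof.
move=> n0 s0 [m [A [B [sA [sB FE]]]]].
rewrite (_ : du F u = fun v => \sum_(k < m) derive1 (A k) u * B k v).
  exact: (spline_sum m (fun k => derive1 (A k) u) n0 sB).
apply/funext => v; rewrite /du derive1E.
exact: (@derive_val _ _ _ _ _ _ _ (tspline_duE n0 s0 sA FE u v)).
Qed.

(** * Polynomials determined on an interval or by derivatives at a point *)

Lemma horner_itv_inj (R : realType) (c d : R) (P Q : {poly R}) : c < d ->
  (forall x, c <= x <= d -> P.[x] = Q.[x]) -> P = Q.
Proof.
move=> cd PQ; apply/eqP; rewrite -subr_eq0; apply/negPn/negP => D0.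
set N := size (P - Q).
have N0 : (0 : R) < N%:R by rewrite ltr0n size_poly_gt0.
(* These are [N] distinct points of the interval, more roots than a nonzero polynomial of size [N]
   can have. *)
pose t (i : nat) : R := c + (d - c) * (i%:R / N%:R).
suff : (size [seq t i | i <- iota 0 N] < N)%N by rewrite size_map size_iota ltnn.
apply: max_poly_roots => //.
  apply/allP => _ /mapP[i + ->]; rewrite mem_iota add0n => /andP[_ iN].
  rewrite rootE !hornerE PQ ?subrr// /t.
  have i0 : (0 : R) <= i%:R / N%:R by rewrite divr_ge0// ltW.
  have i1 : i%:R / N%:R <= (1 : R) by rewrite ler_pdivrMr// mul1r ler_nat ltnW.
  by apply/andP; split; nra.
rewrite map_inj_uniq ?iota_uniq// => i j /addrI /mulfI.
by rewrite subr_eq0 gt_eqF// => /(_ isT)/divIf; rewrite gt_eqF// => /(_ isT)/eqP; rewrite eqr_nat => /eqP.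
Qed.

Lemma deriv_eq0_size (R : realType) (p : {poly R}) : p^`() = 0 -> (size p <= 1)%N.
Proof.
move=> dp; apply/leq_sizeP => -[//|j] _; have := congr1 (fun q : {poly R} => q`_j) dp.
by rewrite /= coef_deriv coef0 => /eqP; rewrite mulrn_eq0/= => /eqP.
Qed.

(** Induction by integration: the derivative is a multiple of a power of X - x, and vanishing at x
    fixes the constant of integration. *)
Lemma poly_vanishing_derivatives (R : realType) (x : R) q (D : {poly R}) :
  (size D <= q.+1)%N -> (forall k, (k < q)%N -> D^`(k).[x] = 0) ->
  exists c, D = c *: ('X - x%:P) ^+ q.
Proof.
elim: q D => [|q IH] D sD Dx.
  by exists D`_0; rewrite expr0 alg_polyC -size1_polyC.
have [|k kq|c Dc] := IH D^`().
- have [->|D0] := eqVneq D 0; first by rewrite deriv0 size_poly0.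
  by rewrite -ltnS (leq_trans (lt_size_deriv D0)).
- by rewrite -derivSn Dx.
exists (c / q.+1%:R).
pose E := D - (c / q.+1%:R) *: ('X - x%:P) ^+ q.+1.
have dE : E^`() = 0.
  rewrite /E derivB derivZ deriv_exp derivXsubC mul1r Dc/=.
  by rewrite -scalerMnr scalerMnl -mulr_natr divfK ?subrr// pnatr_eq0.
have /size1_polyC Ec := deriv_eq0_size dE.
have : E.[x] = 0.
  have := Dx 0%N isT; rewrite derivn0 /E !hornerE => ->.
  by rewrite subrr expr0n mulr0 subr0.
rewrite Ec hornerC => E0; move: Ec; rewrite E0 => /eqP; rewrite subr_eq0 => /eqP.
by [].
Qed.

(** The jumps are P1 - P2 = c (X - x)^p and Q1 - Q2 = d (X - x)^p, so d (X - x)^p = p c b (X -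
    x)^(p-1). Cancelling the common power and evaluating at x gives p c b(x) = 0. *)
Lemma poly_jump_eq (R : realType) (x : R) p (b P1 P2 Q1 Q2 : {poly R}) :
  (0 < p)%N -> b.[x] != 0 ->
  (size P1 <= p.+1)%N -> (size P2 <= p.+1)%N -> (size Q1 <= p.+1)%N -> (size Q2 <= p.+1)%N ->
  (forall k, (k < p)%N -> P1^`(k).[x] = P2^`(k).[x]) ->
  (forall k, (k < p)%N -> Q1^`(k).[x] = Q2^`(k).[x]) ->
  Q1 = b * P1^`() -> Q2 = b * P2^`() -> P1 = P2.
Proof.
case: p => // p _ bx sP1 sP2 sQ1 sQ2 mP mQ Q1E Q2E.
have sB (A B : {poly R}) : (size A <= p.+2)%N -> (size B <= p.+2)%N -> (size (A - B)%R <= p.+2)%N.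
  by move=> sA sB; rewrite (leq_trans (size_polyD _ _))// geq_max sA size_polyN.
have [c Pc] : exists c, P1 - P2 = c *: ('X - x%:P) ^+ p.+1.
  apply: poly_vanishing_derivatives; first exact: sB.
  by move=> k kp; rewrite derivnB !hornerE mP// subrr.
have [d Qd] : exists d, Q1 - Q2 = d *: ('X - x%:P) ^+ p.+1.
  apply: poly_vanishing_derivatives; first exact: sB.
  by move=> k kp; rewrite derivnB !hornerE mQ// subrr.
have dXn : (c *: ('X - x%:P) ^+ p.+1)^`() = (c *+ p.+1) *: ('X - x%:P) ^+ p.
  by rewrite derivZ deriv_exp derivXsubC mul1r/= -scalerMnr scalerMnl.
have : (d *: ('X - x%:P)) * ('X - x%:P) ^+ p = ((c *+ p.+1) *: b) * ('X - x%:P) ^+ p.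
  by rewrite -!scalerAl -exprS -Qd scalerAr -dXn -Pc derivB mulrBr -Q1E -Q2E.
have Xp0 : ('X - x%:P) ^+ p != 0 :> {poly R} by rewrite expf_neq0// polyXsubC_eq0.
move=> /(mulIf Xp0)/(congr1 (fun q : {poly R} => q.[x])).
rewrite /= !hornerE subrr mulr0 => /esym/eqP.
rewrite mulf_eq0 (negbTE bx) orbF mulrn_eq0/= => /eqP c0.
by apply/eqP; rewrite -subr_eq0 Pc c0 scale0r.
Qed.

(** * Rigidity of splines under multiplication by linear factors *)

Lemma knot_itv_cell0 (R : realType) (v : R) n : (0 < n)%N -> 0 <= v <= 1 ->
  exists2 i, (i < n)%N & knot 0 n i <= v <= knot 0 n i.+1.
Proof.
move=> n0 v01; have [i ilt ci] := cell_cover 0 v n0.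
by exists i => //; apply: cell_itv => //; rewrite add0r.
Qed.

Lemma knot_itv_sub (R : realType) (v : R) n i : (0 < n)%N -> (i < n)%N ->
  knot 0 n i <= v <= knot 0 n i.+1 -> 0 <= v <= 1.
Proof.
move=> n0 ilt /andP[h1 h2].
have k0 : (0 : R) <= knot 0 n i by rewrite -{1}(knot0 0 n) knot_le.
have k1 : knot 0 n i.+1 <= (1 : R).
  by rewrite -[X in _ <= X]add0r -(knotn 0 n0) knot_le.
by rewrite (le_trans k0)// (le_trans h2).
Qed.

Lemma linear_root_unique (R : realType) (b : {poly R}) (x y : R) :
  b != 0 -> (size b <= 2)%N -> b.[x] = 0 -> b.[y] = 0 -> x = y.
Proof.
move=> b0 sb bx by0; apply/eqP/negPn/negP => xy.
have /(_ [:: x; y]) := max_poly_roots b0; rewrite /= !rootE bx by0 !eqxx inE xy.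
by move=> /(_ isT isT); rewrite ltnNge sb.
Qed.

(** The break [t] is chosen before [f]: all such splines share it, which is what bounds the
    dimension of a space of them. *)
Lemma spline_linear_multiple_break (R : realType) (n p : nat) (b : {poly R}) :
  (0 < n)%N -> (1 < p)%N -> b != 0 -> (size b <= 2)%N ->
  exists t : R, forall f s : R -> R, spline 0 n p p.-1 f -> spline 0 n p p.-1 s ->
    (forall v, 0 <= v <= 1 -> s v = b.[v] * derive1 f v) ->
    exists P Q : {poly R}, [/\ (size P <= p.+1)%N, (size Q <= p.+1)%N &
      forall v, 0 <= v <= 1 -> f v = if v <= t then P.[v] else Q.[v]].
Proof.
move=> n0 p1 b0 sb.
(* [j] is the index of a knot that is a root of [b]. Without such a knot the default 0 puts the
   break at the left end, where no two pieces meet. *)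
have [j [jn jP]] : exists j, (j < n)%N /\ forall i, (0 < i < n)%N -> i != j ->
    b.[knot 0 n i] != 0.
  have [[j [jn bj]]|H] := pselect (exists j, (j < n)%N /\ b.[knot 0 n j] = 0).
    exists j; split=> // i _ ij; apply: contra_neq ij => bi.
    have := linear_root_unique b0 sb bi bj => /eqP.
    by rewrite eq_le !knot_le// -eqn_leq => /eqP.
  exists 0%N; split=> // i /andP[_ ilt] _; apply/eqP => bi; apply: H; by exists i.
exists (knot 0 n j) => f s /(spline_cellE _ _ _ _ n0)[P pP fP] /(spline_cellE _ _ _ _ n0)[Q pQ sQ] sE.
have p0 : (0 < p.-1)%N by lia.
(* A cell has positive length, so the identity of functions becomes one of polynomials. *)
have QE i : (i < n)%N -> Q i = b * (P i)^`().
  move=> ilt; apply: (@horner_itv_inj _ (knot 0 n i) (knot 0 n i.+1)).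
    by rewrite knot_lt.
  move=> x xi; have cx := itv_cell xi.
  rewrite hornerM -(spline_derive1_cell n0 p0 pP fP ilt cx) -sE; last exact: knot_itv_sub xi.
  by rewrite (sQ i).
have step i : (0 < i < n)%N -> i != j -> P i.-1 = P i.
  move=> /andP[i0 ilt] ij; case: (pP) (pQ) => sP mP [sQ' mQ].
  have ilt' : (i.-1 < n)%N by lia.
  have hi : (0 < i < n)%N by rewrite i0.
  apply: (@poly_jump_eq _ (knot 0 n i) p b _ _ (Q i.-1) (Q i)) => //; try exact: QE.
  - by lia.
  - exact: jP.
  - by move=> k kp; apply: mP => //; lia.
  - by move=> k kp; apply: mQ => //; lia.
have Plow i : (i < j)%N -> P i = P 0%N.
  elim: i => // i IH ij; rewrite -IH ?(ltnW ij)//; apply/esym.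
  by apply: (step i.+1); lia.
have Phigh i : (j <= i)%N -> (i < n)%N -> P i = P j.
  elim: i => [|i IH] ji ilt; first by congr P; lia.
  have [->//|ij] := eqVneq j i.+1.
  by rewrite -(step i.+1)/= ?IH//; lia.
exists (P 0%N), (P j); case: (pP) => sP mP; split=> // v v01.
have [i ilt vi] := knot_itv_cell0 n0 v01.
have fvi := fP i v ilt (itv_cell vi); move/andP: vi => [vi1 vi2].
case: ifPn => vj; last first.
  rewrite fvi Phigh//; rewrite leqNgt; apply/negP => ij; case/negP: vj.
  by rewrite (le_trans vi2)// knot_le.
have [ij|ji] := ltnP i j; first by rewrite fvi Plow.
(* At the break the chosen cell may be the one on the right, whereas the left polynomial is wanted;
   it has the same value there. *)
have ev : v = knot 0 n j.
  by apply/eqP; rewrite eq_le vj (le_trans _ vi1)// knot_le.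
have [j0|j0] := posnP j.
  by apply: fP => //; apply: itv_cell; rewrite ev j0 lexx knot_le.
rewrite -(Plow j.-1) ?prednK//; apply: fP; first lia.
by apply: itv_cell; rewrite prednK// ev lexx andbT knot_le// leq_pred.
Qed.

(** Inverting the coefficient matrix of [aL] and [aR] makes both g and v g agree with splines on
    [0, 1]. The second lowers the degree of the pieces of g below p, and pieces of degree below p
    that match to order p - 1 at a knot coincide. *)
Lemma spline_both_multiples_poly (R : realType) (n p : nat) (aL aR : {poly R}) (g sL sR : R -> R) :
  (0 < n)%N -> (1 < p)%N -> (size aL <= 2)%N -> (size aR <= 2)%N ->
  (forall c1 c2 : R, c1 *: aL + c2 *: aR = 0 -> c1 = 0 /\ c2 = 0) ->
  spline 0 n p p.-1 sL -> spline 0 n p p.-1 sR ->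
  (forall v, 0 <= v <= 1 -> sL v = aL.[v] * g v) ->
  (forall v, 0 <= v <= 1 -> sR v = aR.[v] * g v) ->
  exists2 P : {poly R}, (size P <= p.+1)%N & forall v, 0 <= v <= 1 -> g v = P.[v].
Proof.
move=> n0 p1 sizL sizR indep spL spR sLE sRE.
have linE (a : {poly R}) : (size a <= 2)%N -> a = (a`_1)%:P * 'X + (a`_0)%:P.
  move=> sa; apply/polyP => i; rewrite coefD coefMX !coefC.
  case: i => [|[|i]]; rewrite /= ?add0r ?addr0//.
  by rewrite (leq_sizeP _ _ sa).
have := linE _ sizL; have := linE _ sizR.
set r1 := aR`_1; set r0 := aR`_0; set l1 := aL`_1; set l0 := aL`_0 => aRE aLE.
(* If [d] were 0, the combinations giving [d] and [- d * X] would be trivial relations; independence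
   then kills [l1] and [l0], hence [aL], which is impossible. *)
pose d := l0 * r1 - l1 * r0.
have d0 : d != 0.
  apply/eqP => d0.
  have [|r10 l10] := indep r1 (- l1).
    have -> : r1 *: aL + - l1 *: aR = d%:P.
      by rewrite aLE aRE -!mul_polyC /d !(rmorphB, rmorphM, rmorphN)/=; ring.
    by rewrite d0.
  have [|r00 l00] := indep r0 (- l0).
    have -> : r0 *: aL + - l0 *: aR = - d%:P * 'X.
      by rewrite aLE aRE -!mul_polyC /d !(rmorphB, rmorphM, rmorphN)/=; ring.
    by rewrite d0 oppr0 mul0r.
  have := indep 1 0; rewrite scale0r addr0 scale1r aLE.
  have -> : l1 = 0 by lra.
  have -> : l0 = 0 by lra.
  by rewrite polyC0 mul0r addr0 => /(_ erefl)[/eqP]; rewrite oner_eq0.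
have evL v : aL.[v] = l1 * v + l0 by rewrite aLE !hornerE.
have evR v : aR.[v] = r1 * v + r0 by rewrite aRE !hornerE.
have combo c1 c2 : spline 0 n p p.-1 (fun v => c1 * sL v + c2 * sR v).
  have := spline_scaleD c2 n0 (spline_scaleD c1 n0 (spline0 0 p p.-1 n0) spL) spR.
  by under eq_fun do rewrite add0r.
(* By Cramer's rule [T] holds the pieces of g, and [U] below those of v g. *)
have /(spline_cellE _ _ _ _ n0)[T [sT mT] gT] := combo (d^-1 * r1) (- (d^-1 * l1)).
have /(spline_cellE _ _ _ _ n0)[U [sU mU] xU] := combo (- (d^-1 * r0)) (d^-1 * l0).
have gE v : 0 <= v <= 1 -> d^-1 * r1 * sL v + - (d^-1 * l1) * sR v = g v.
  move=> v01; rewrite sLE// sRE// evL evR.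
  by rewrite -[RHS]mul1r -(mulVf d0) /d; ring.
have xgE v : 0 <= v <= 1 -> - (d^-1 * r0) * sL v + d^-1 * l0 * sR v = v * g v.
  move=> v01; rewrite sLE// sRE// evL evR.
  by rewrite -[RHS]mul1r -(mulVf d0) /d; ring.
have UE i : (i < n)%N -> U i = T i * 'X.
  move=> ilt; apply: (@horner_itv_inj _ (knot 0 n i) (knot 0 n i.+1)).
    by rewrite knot_lt.
  move=> x xi; have cx := itv_cell xi; have x01 := knot_itv_sub n0 ilt xi.
  by rewrite hornerMX -(xU i)// -(gT i)// xgE// gE// mulrC.
have sT' i : (i < n)%N -> (size (T i) <= p)%N.
  move=> ilt; have [->|T0] := eqVneq (T i) 0; first by rewrite size_poly0.
  by have := sU i; rewrite UE// size_mulX.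
have step i : (i.+1 < n)%N -> T i.+1 = T i.
  move=> ilt; apply/eqP; rewrite -subr_eq0; apply/eqP.
  have sD : (size (T i.+1 - T i)%R <= p)%N.
    by rewrite (leq_trans (size_polyD _ _))// geq_max size_polyN !sT'// ltnW.
  (* The difference is a multiple of a p-th power but has degree below p, so the multiple is
     zero. *)
  have [||c Dc] := @poly_vanishing_derivatives _ (knot 0 n i.+1) p (T i.+1 - T i).
  - exact: leqW.
  - by move=> k kp; rewrite derivnB !hornerE -mT ?subrr//; lia.
  have [c0|c0] := eqVneq c 0; first by rewrite Dc c0 scale0r.
  by move: sD; rewrite Dc size_scale// size_exp_XsubC ltnn.
have T0 i : (i < n)%N -> T i = T 0%N.
  by elim: i => // i IH ilt; rewrite step// IH// ltnW.
exists (T 0%N) => // v v01.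
have [i ilt vi] := knot_itv_cell0 n0 v01.
by rewrite -gE// (gT i v ilt (itv_cell vi)) T0.
Qed.

(** Each function is encoded by a row of q + q coefficients. More rows than that have a nontrivial
    linear relation, valid on both sides of the common break [t]. *)
Lemma dim_le01_two_polys (R : realType) (G : (R -> R) -> Prop) (t : R) q :
  (forall g, G g -> exists P Q : {poly R}, [/\ (size P <= q)%N, (size Q <= q)%N &
     forall v, 0 <= v <= 1 -> g v = if v <= t then P.[v] else Q.[v]]) ->
  dim_le01 G (q + q).
Proof.
move=> GP m g Gg free; rewrite leqNgt; apply/negP => qm.
have /choice[PQ PQP] : forall i : 'I_m, exists PQ : {poly R} * {poly R},
    [/\ (size PQ.1 <= q)%N, (size PQ.2 <= q)%N &
     forall v, 0 <= v <= 1 -> g i v = if v <= t then PQ.1.[v] else PQ.2.[v]].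
  by move=> i; have [P [Q H]] := GP _ (Gg i); exists (P, Q).
pose M : 'M[R]_(m, q + q) :=
  \matrix_i row_mx (poly_rV (PQ i).1 : 'rV_q) (poly_rV (PQ i).2 : 'rV_q).
have : kermx M != 0.
  by rewrite kermx_eq0 -row_leq_rank -ltnNge (leq_ltn_trans (rank_leq_col _)).
move=> /rowV0Pn[c /sub_kermxP cM c0].
(* The kernel vector [c] gives a relation among the [g i], so freeness forces it to vanish. *)
case/negP: c0; apply/eqP/rowP => i; rewrite mxE; move: i.
apply: (free (fun i => c 0 i)) => v v01.
have cME : row_mx (\sum_i c 0 i *: (poly_rV (PQ i).1 : 'rV_q))
    (\sum_i c 0 i *: (poly_rV (PQ i).2 : 'rV_q)) = 0.
  rewrite -cM mulmx_sum_row -[RHS]hsubmxK; congr row_mx.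
    by rewrite linear_sum; apply: eq_bigr => i _; rewrite linearZ/= rowK row_mxKl.
  by rewrite linear_sum; apply: eq_bigr => i _; rewrite linearZ/= rowK row_mxKr.
have : \sum_i c 0 i *: (PQ i).1 = 0 /\ \sum_i c 0 i *: (PQ i).2 = 0.
  move: cME; rewrite -[RHS](@row_mx0 _ 1 q q) => /eq_row_mx[e1 e2].
  split; [have := congr1 rVpoly e1|have := congr1 rVpoly e2];
    rewrite linear0 linear_sum => E; rewrite -[RHS]E; apply: eq_bigr => i _;
    by rewrite linearZ/= poly_rV_K//; have [] := PQP i.
case=> e1 e2.
case: (leP v t) => vt.
  have := congr1 (fun p : {poly R} => p.[v]) e1; rewrite /= horner0 horner_sum => E.
  rewrite -[RHS]E; apply: eq_bigr => i _; rewrite hornerZ.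
  by have [_ _ ->//] := PQP i; rewrite vt.
have := congr1 (fun p : {poly R} => p.[v]) e2; rewrite /= horner0 horner_sum => E.
rewrite -[RHS]E; apply: eq_bigr => i _; rewrite hornerZ.
by have [_ _ ->//] := PQP i; rewrite leNgt vt.
Qed.

(** * Traces and transversal derivatives on the interface *)

(** The witnesses are the pullback of phi to the left patch at u = 0 and the u-derivatives of both
    pullbacks there. The left formula is the definition of the transversal vector; the right one
    also uses the analysis-suitability relation. *)
Lemma trace_space_splines (R : realType) (n p : nat) (FL1 FL2 FR1 FR2 : R -> R -> R)
    (aL aR bL bR : {poly R}) (g0 g1 : R -> R) :
  (0 < n)%N -> (1 < p)%N ->
  tspline (-1) n p p.-1 FL1 -> tspline (-1) n p p.-1 FL2 ->
  tspline 0 n p p.-1 FR1 -> tspline 0 n p p.-1 FR2 ->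
  (forall u v, -1 <= u <= 0 -> 0 <= v <= 1 -> jac FL1 FL2 u v != 0) ->
  (forall u v, 0 <= u <= 1 -> 0 <= v <= 1 -> jac FR1 FR2 u v != 0) ->
  (forall v, 0 <= v <= 1 -> FL1 0 v = FR1 0 v /\ FL2 0 v = FR2 0 v) ->
  (forall v, 0 <= v <= 1 -> 0 < aL.[v] * aR.[v]) ->
  (forall v, 0 <= v <= 1 ->
     aR.[v] * du FL1 0 v - aL.[v] * du FR1 0 v
       = (aR.[v] * bL.[v] - aL.[v] * bR.[v]) * dv FL1 0 v /\
     aR.[v] * du FL2 0 v - aL.[v] * du FR2 0 v
       = (aR.[v] * bL.[v] - aL.[v] * bR.[v]) * dv FL2 0 v) ->
  trace_space n p FL1 FL2 FR1 FR2 aL bL g0 g1 ->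
  exists f sL sR : R -> R,
    [/\ spline 0 n p p.-1 f, spline 0 n p p.-1 sL, spline 0 n p p.-1 sR &
    forall v, 0 <= v <= 1 -> [/\ g0 v = f v,
      sL v = aL.[v] * g1 v + bL.[v] * derive1 f v &
      sR v = aR.[v] * g1 v + bR.[v] * derive1 f v]].
Proof.
move=> n0 p1 tL1 tL2 tR1 tR2 jL jR FLR aLR G1 [phi [Dphi [[[fL [tfL phiL]] [fR [tfR phiR]]] [C1phi gE]]]].
have s0 : (0 < p.-1)%N by lia.
have ltN10 : (-1 : R) < 0 by lra.
have C1L1 := tspline_C1_fun n0 s0 tL1; have C1L2 := tspline_C1_fun n0 s0 tL2.
have C1R1 := tspline_C1_fun n0 s0 tR1; have C1R2 := tspline_C1_fun n0 s0 tR2.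
have C1fL := tspline_C1_fun n0 s0 tfL; have C1fR := tspline_C1_fun n0 s0 tfR.
have imgL u v : -1 <= u <= 0 -> 0 <= v <= 1 -> Omega FL1 FL2 FR1 FR2 (FL1 u v, FL2 u v).
  by move=> hu hv; left; exists u, v; rewrite addNr.
have imgR u v : 0 <= u <= 1 -> 0 <= v <= 1 -> Omega FL1 FL2 FR1 FR2 (FR1 u v, FR2 u v).
  by move=> hu hv; right; exists u, v; rewrite add0r.
have chainL := C1_on_chain_rule ltN10 ltr01 C1L1 C1L2 C1fL imgL phiL jL C1phi.
have chainR := C1_on_chain_rule ltr01 ltr01 C1R1 C1R2 C1fR imgR phiR jR C1phi.
exists (fL 0), (du fL 0), (du fR 0); split.
- exact: tspline_spline tfL.
- exact: tspline_du_spline tfL.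
- exact: tspline_du_spline tfR.
move=> v v01.
have z1 : -1 <= (0 : R) <= 0 by lra.
have z2 : 0 <= (0 : R) <= 1 by lra.
have [uL vL] := chainL 0 v z1 v01.
have [uR _] := chainR 0 v z2 v01.
have [e1 e2] := FLR v v01.
have [g0E g1E] := gE v v01.
have aL0 : aL.[v] != 0.
  by apply/eqP => a0; have := aLR v v01; rewrite a0 mul0r ltxx.
have aR0 : aR.[v] != 0.
  by apply/eqP => a0; have := aLR v v01; rewrite a0 mulr0 ltxx.
have [h1 h2] := G1 v v01.
have vL' : derive1 (fL 0) v = dv fL 0 v by [].
(* The patches agree at u = 0, so both sides involve the same gradient value. *)
rewrite -e1 -e2 in uR.
rewrite g1E vL' vL uL uR /dvec /dot2/= /F0.
move: (Dphi _) => D.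
split; first by rewrite g0E -phiL.
  by field.
(* After multiplication by [aL], the u-derivative of the right patch appears only in the product
   that the analysis-suitability relation expresses through the left patch. *)
apply: (mulfI aL0); move: h1 h2 aL0.
move: (du FL1 0 v) (du FL2 0 v) (du FR1 0 v) (du FR2 0 v) (dv FL1 0 v) (dv FL2 0 v) => x1 x2 y1 y2 z3 z4.
move: (aL.[v]) (aR.[v]) (bL.[v]) (bR.[v]) => l r b c h1 h2 l0.
have {}h1 : l * y1 = r * x1 - (r * b - l * c) * z3 by lra.
have {}h2 : l * y2 = r * x2 - (r * b - l * c) * z4 by lra.
transitivity (D.1 * (l * y1) + D.2 * (l * y2)); first by ring.
by rewrite h1 h2; field.
Qed.

(** * From traces to the two dimension bounds *)

Unset Implicit Arguments. Set Strict Implicit. Set Printing Implicit Defensive.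

Theorem theorem2 (p : nat) : (2 <= p)%N ->
  exists C : nat,
  forall (R : realType) (n : nat), (0 < n)%N ->
  forall FL1 FL2 FR1 FR2 : R -> R -> R,
    tspline (-1) n p p.-1 FL1 -> tspline (-1) n p p.-1 FL2 ->
    tspline 0 n p p.-1 FR1 -> tspline 0 n p p.-1 FR2 ->
    (forall u v, -1 <= u <= 0 -> 0 <= v <= 1 -> jac FL1 FL2 u v != 0) ->
    (forall u v, 0 <= u <= 1 -> 0 <= v <= 1 -> jac FR1 FR2 u v != 0) ->
    interior (patch_img FL1 FL2 (-1)) `&` interior (patch_img FR1 FR2 0) = set0 ->
    (forall v, 0 <= v <= 1 -> FL1 0 v = FR1 0 v /\ FL2 0 v = FR2 0 v) ->
  forall aL aR bL bR : {poly R},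
    (size aL <= 2)%N -> (size aR <= 2)%N -> (size bL <= 2)%N -> (size bR <= 2)%N ->
    (forall v, 0 <= v <= 1 -> 0 < aL.[v] * aR.[v]) ->
    (forall v, 0 <= v <= 1 ->
       aR.[v] * du FL1 0 v - aL.[v] * du FR1 0 v
         = (aR.[v] * bL.[v] - aL.[v] * bR.[v]) * dv FL1 0 v /\
       aR.[v] * du FL2 0 v - aL.[v] * du FR2 0 v
         = (aR.[v] * bL.[v] - aL.[v] * bR.[v]) * dv FL2 0 v) ->
  forall G0 G1 : (R -> R) -> Prop,
    lin_space G0 -> lin_space G1 ->
    (forall g0 g1, G0 g0 -> G1 g1 -> trace_space n p FL1 FL2 FR1 FR2 aL bL g0 g1) ->
    ((bL != 0 \/ bR != 0) -> dim_le01 G0 C) /\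
    ((forall c1 c2 : R, c1 *: aL + c2 *: aR = 0 -> c1 = 0 /\ c2 = 0) ->
       dim_le01 G1 C).
Proof.
(* The bound counts the coefficients of two polynomials of degree at most p. *)
move=> p1; exists (p.+1 + p.+1)%N => R n n0 FL1 FL2 FR1 FR2 tL1 tL2 tR1 tR2 jL jR _ FLR.
move=> aL aR bL bR saL saR sbL sbR aLR AS G0 G1 [G00 _] [G10 _] Gtr.
have tr g0 g1 (h0 : G0 g0) (h1 : G1 g1) :=
  trace_space_splines n0 p1 tL1 tL2 tR1 tR2 jL jR FLR aLR AS (Gtr g0 g1 h0 h1).
split=> [b0|indep].
  have [b [b0' [sb bE]]] : exists b : {poly R}, b != 0 /\ (size b <= 2)%N /\
      forall g, G0 g -> exists f s, [/\ spline 0 n p p.-1 f, spline 0 n p p.-1 s &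
        forall v, 0 <= v <= 1 -> g v = f v /\ s v = b.[v] * derive1 f v].
    case: b0 => b0; [exists bL|exists bR]; do 2!split=> //.
    - move=> g Gg; have [f [sL [sR [pf pL _ E]]]] := tr _ _ Gg G10.
      by exists f, sL; split=> // v /E[-> -> _]; rewrite mulr0 add0r.
    - move=> g Gg; have [f [sL [sR [pf _ pR E]]]] := tr _ _ Gg G10.
      by exists f, sR; split=> // v /E[-> _ ->]; rewrite mulr0 add0r.
  have [t tP] := spline_linear_multiple_break n0 p1 b0' sb.
  apply: (@dim_le01_two_polys R G0 t) => g /bE[f [s [pf ps E]]].
  have [P [Q [sP sQ fE]]] := tP f s pf ps (fun v v01 => (E v v01).2).
  by exists P, Q; split=> // v v01; rewrite (E v v01).1 fE.
(* One polynomial serves on both sides here, so the break 1 is arbitrary. *)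
apply: (@dim_le01_two_polys R G1 1) => g Gg.
have [f [sL [sR [pf pL pR E]]]] := tr _ _ G00 Gg.
(* [f] is known to vanish only on [0, 1], while [derive1] is two-sided at the endpoints; passing
   through the pieces closes this gap. *)
have df v : 0 <= v <= 1 -> derive1 f v = 0.
  move=> v01; have /(spline_cellE _ _ _ _ n0)[P pP fP] := pf.
  have [i ilt vi] := knot_itv_cell0 n0 v01.
  have P0 : P i = 0.
    apply: (@horner_itv_inj _ (knot 0 n i) (knot 0 n i.+1)); first by rewrite knot_lt.
    move=> x xi; have [f0 _ _] := E x (knot_itv_sub n0 ilt xi).
    by rewrite horner0 -(fP i x ilt (itv_cell xi)) -f0.
  have p0 : (0 < p.-1)%N by rewrite -ltnS prednK// ltnW.
  by rewrite (spline_derive1_cell n0 p0 pP fP ilt (itv_cell vi)) P0 deriv0 horner0.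
have [P sP gE] : exists2 P : {poly R}, (size P <= p.+1)%N & forall v, 0 <= v <= 1 -> g v = P.[v].
  apply: (spline_both_multiples_poly n0 p1 saL saR indep pL pR) => v v01.
    by have [_ -> _] := E v v01; rewrite df// mulr0 addr0.
  by have [_ _ ->] := E v v01; rewrite df// mulr0 addr0.
by exists P, P; split=> // v v01; rewrite if_same gE.
Qed.
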